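(* Let $1\le p<n$ be integers, let $B,\tilde B\in\mathbb{R}^{(n-p)\times p}$, and let $P=\varphi(B)$, $\tilde P=\varphi(\tilde B)\in\mathrm{Gr}(n,p)$. Put $$M:=\max_{t\in[0,1]}\|d\varphi_{\tilde B+t(B-\tilde B)}\|_{\mathrm{F},0}.$$ If $\|B-\tilde B\|_{\mathrm F}<\frac1M$ and $\operatorname{dist}(P,\tilde P)<\frac{\pi}{2}$, then $$\operatorname{dist}(P,\tilde P)\le\arcsin\!\left(M\|B-\tilde B\|_{\mathrm F}\right)=M\|B-\tilde B\|_{\mathrm F}+\mathcal{O}\!\left(\|B-\tilde B\|_{\mathrm F}^3\right),$$ where the $\mathcal O$-term refers to $\|B-\tilde B\|_{\mathrm F}\to0$. Moreover, $M\le\sqrt{\tfrac52}+1$.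
   Context: $\mathrm{Gr}(n,p)=\{P\in\mathbb{R}^{n\times n}\mid P^2=P,\ P^T=P,\ \operatorname{rank}P=p\}$ is the Grassmann manifold of rank-$p$ orthogonal projectors, an embedded submanifold of the space $\mathrm{sym}(n)$ of real symmetric $n\times n$ matrices. On $\mathrm{sym}(n)$ use the inner product $\langle X,Y\rangle_0=\frac12\operatorname{tr}(X^TY)$ with norm $\|\cdot\|_0$; $\mathrm{Gr}(n,p)$ carries the Riemannian metric obtained by restricting $\langle\cdot,\cdot\rangle_0$ to its tangent spaces, and $\operatorname{dist}$ is the associated Riemannian distance. $\|\cdot\|_{\mathrm F}$ is the Frobenius norm. The local parameterization is $$\varphi:\mathbb{R}^{(n-p)\times p}\to\mathrm{Gr}(n,p),\qquad \varphi(B)=\begin{pmatrix}I_p\\ B\end{pmatrix}(I_p+B^TB)^{-1}\begin{pmatrix}I_p&B^T\end{pmatrix},$$ with differential $d\varphi_B:\mathbb{R}^{(n-p)\times p}\to T_{\varphi(B)}\mathrm{Gr}(n,p)\subset\mathrm{sym}(n)$ and operator norm $\|d\varphi_B\|_{\mathrm{F},0}=\max_{\|V\|_{\mathrm F}=1}\|d\varphi_B(V)\|_0$. *)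

(* Defs.v *)
From HB Require Import structures.
From mathcomp Require Import all_boot all_order all_algebra.
From mathcomp Require Import all_classical all_reals all_analysis.

Set Implicit Arguments.
Unset Strict Implicit.
Unset Printing Implicit Defensive.

Import Order.TTheory GRing.Theory Num.Theory.
Import numFieldNormedType.Exports.

Local Open Scope classical_set_scope.
Local Open Scope ring_scope.

(* The ambient normed-module structure on matrices (the sup norm [mx_norm]) is
   used only for its topology, i.e. for differentiability and continuity; all
   metric quantities are expressed with [normF] and [norm0]. *)

Section Norms.
Variables (R : realType) (m n : nat).

Definition normF (X : 'M[R]_(m, n)) : R :=
  Num.sqrt (\sum_(i < m) \sum_(j < n) X i j ^+ 2).

Definition inner0 (X Y : 'M[R]_n) : R := 2^-1 * \tr (X^T *m Y).

Definition norm0 (X : 'M[R]_n) : R := Num.sqrt (inner0 X X).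

End Norms.

Section Grassmann.
Variables (R : realType) (n p : nat).

Definition Gr : set 'M[R]_n :=
  [set P | [/\ P *m P = P, P^T = P & \rank P = p]].

Definition C1 (g : R -> 'M[R]_n) : Prop :=
  (forall t, derivable g t 1) /\ continuous (derive1 g).

(* A map is C^1 on a closed interval (one-sided derivatives at the ends) iff it
   is the restriction of a C^1 map on R.  The extension [g] lives in the ambient
   matrix space; it need not stay in the manifold. *)
Definition piecewise_C1 (c : R -> 'M[R]_n) : Prop :=
  exists s : seq R, itv_partition 0 1 s /\
    forall i, (i < size s)%N ->
      exists g, C1 g /\
        {in `[nth 0 (0 :: s) i, nth 0 (0 :: s) i.+1], c =1 g}.

(* The derivative of a piecewise C^1 curve on [0, 1] may fail to exist at the
   finitely many breakpoints, which the Lebesgue integral ignores. *)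
Definition curve_length (c : R -> 'M[R]_n) : R :=
  \int[lebesgue_measure]_(t in `[0, 1]) norm0 (derive1 c t).

Definition dist (P Q : 'M[R]_n) : R :=
  inf [set curve_length c | c in
    [set c : R -> 'M[R]_n |
      [/\ piecewise_C1 c, forall t, t \in `[0, 1] -> Gr (c t), c 0 = P
        & c 1 = Q]]].

End Grassmann.

Section Parameterization.
Variables (R : realType) (n p : nat) (hpn : (p <= n)%N).

(* [castmx] only identifies the dimension [p + (n - p)] with [n]. *)
Definition phi (B : 'M[R]_(n - p, p)) : 'M[R]_n :=
  castmx (subnKC hpn, subnKC hpn)
    (col_mx 1%:M B *m invmx (1%:M + B^T *m B) *m row_mx 1%:M B^T).

(* Both suprema below are maxima: continuous functions on compact sets. *)
Definition dphi_opnorm (B : 'M[R]_(n - p, p)) : R :=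
  sup [set norm0 ('d phi B V) | V in [set V | normF V = 1]].

Definition segment_max (B Bt : 'M[R]_(n - p, p)) : R :=
  sup [set dphi_opnorm (Bt + t *: (B - Bt)) | t in `[0, 1]].

End Parameterization.

(* Main.v *)
Require Import Defs.
From HB Require Import structures.
From mathcomp Require Import all_boot all_order all_algebra.
From mathcomp Require Import all_classical all_reals all_analysis.
From mathcomp Require Import ring lra.

Set Implicit Arguments.
Unset Strict Implicit.
Unset Printing Implicit Defensive.

Import Order.TTheory GRing.Theory Num.Theory.
Import numFieldNormedType.Exports.

Local Open Scope classical_set_scope.
Local Open Scope ring_scope.

(** [dist] is at most the length of the image under [phi] of the segment from
    [B] to [Bt], which is at most [M * normF (B - Bt)], and [x <= asin x] on
    [0, 1).  For the differential, put [E = [[0, 0], [V, 0]]], [P = phi B] and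
    [P' = phi (B + V)].  Since [1 + E] maps the range of [P] onto that of [P'],
    [P' - P = P' E^T (1 - P) + (1 - P') E P] exactly, so
    ['d phi B V = P E^T (1 - P) + (1 - P) E P] up to a quadratic remainder.  Its
    [norm0] is [normF ((1 - P) E P) <= normF V]; hence even [M <= 1].  The cubic
    remainder of [asin] comes from [asin x = x / sqrt (1 - c^2)] with
    [0 <= c <= x]. *)

(** * Frobenius norm and half-trace norm *)

Section FrobeniusNorm.
Variable R : realType.

Lemma mxtrace_sqr m n (X : 'M[R]_(m, n)) :
  \tr (X^T *m X) = \sum_(i < m) \sum_(j < n) X i j ^+ 2.
Proof.
rewrite /mxtrace exchange_big; apply: eq_bigr => j _ /=.
by rewrite mxE; apply: eq_bigr => i _; rewrite mxE expr2.
Qed.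

Lemma mxtrace_sqr_ge0 m n (X : 'M[R]_(m, n)) : 0 <= \tr (X^T *m X).
Proof.
by rewrite mxtrace_sqr; do 2 (apply: sumr_ge0 => ? _); exact: sqr_ge0.
Qed.

(** In trace form the norm can be computed through transposes, products and blocks. *)
Lemma normFE m n (X : 'M[R]_(m, n)) : normF X = Num.sqrt (\tr (X^T *m X)).
Proof. by rewrite mxtrace_sqr. Qed.

Lemma normF_ge0 m n (X : 'M[R]_(m, n)) : 0 <= normF X.
Proof. exact: sqrtr_ge0. Qed.

Lemma normF_eq0 m n (X : 'M[R]_(m, n)) : normF X = 0 -> X = 0.
Proof.
have row_ge0 i : 0 <= \sum_(j < n) X i j ^+ 2.
  by apply: sumr_ge0 => j _; exact: sqr_ge0.
have S_ge0 : 0 <= \sum_(i < m) \sum_(j < n) X i j ^+ 2 by exact: sumr_ge0.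
move=> /eqP; rewrite /normF sqrtr_eq0 => S_le0; apply/matrixP => i j.
have /psumr_eq0P row0 : \sum_(i < m) \sum_(j < n) X i j ^+ 2 = 0.
  by apply/eqP; rewrite eq_le S_le0.
have /psumr_eq0P X0 := row0 (fun i _ => row_ge0 i) i isT.
by apply/eqP; rewrite mxE -sqrf_eq0 X0// => k _; exact: sqr_ge0.
Qed.

Lemma normFZ m n a (X : 'M[R]_(m, n)) : normF (a *: X) = `|a| * normF X.
Proof.
rewrite !normFE [(a *: X)^T]linearZ/= -scalemxAl -scalemxAr scalerA mxtraceZ.
by rewrite -expr2 sqrtrM ?sqr_ge0// sqrtr_sqr.
Qed.

Lemma normFN m n (X : 'M[R]_(m, n)) : normF (- X) = normF X.
Proof. by rewrite -scaleN1r normFZ normrN1 mul1r. Qed.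

Lemma normF_tr m n (X : 'M[R]_(m, n)) : normF X^T = normF X.
Proof. by rewrite !normFE trmxK mxtrace_mulC. Qed.

Lemma norm0_ge0 n (X : 'M[R]_n) : 0 <= norm0 X.
Proof. exact: sqrtr_ge0. Qed.

Lemma norm0Z n a (X : 'M[R]_n) : norm0 (a *: X) = `|a| * norm0 X.
Proof.
rewrite /norm0 /inner0 [(a *: X)^T]linearZ/= -scalemxAl -scalemxAr.
rewrite scalerA mxtraceZ mulrCA.
by rewrite -expr2 sqrtrM ?sqr_ge0// sqrtr_sqr.
Qed.

End FrobeniusNorm.

(** * Orthogonal projectors and their tangent vectors *)

Section OrthogonalProjectors.
Variables (R : realType) (n : nat).
Implicit Types P E : 'M[R]_n.

Definition orthoproj P := P *m P = P /\ P^T = P.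

Lemma orthoproj_compl P : orthoproj P -> orthoproj (1%:M - P).
Proof.
move=> [PP tP]; split; last by rewrite linearB/= trmx1 tP.
by rewrite mulmxBr mulmx1 mulmxBl mul1mx PP subrr subr0.
Qed.

Lemma orthoproj_mul_compl P : orthoproj P -> P *m (1%:M - P) = 0.
Proof. by move=> [PP _]; rewrite mulmxBr mulmx1 PP subrr. Qed.

Lemma orthoproj_compl_mul P : orthoproj P -> (1%:M - P) *m P = 0.
Proof. by move=> [PP _]; rewrite mulmxBl mul1mx PP subrr. Qed.

(** Pythagoras: [P *m X] and [(1%:M - P) *m X] are orthogonal and add up to [X], so their squared
    norms add up to that of [X]. *)
Lemma normF_orthoproj_mul P m (X : 'M[R]_(n, m)) :
  orthoproj P -> normF (P *m X) <= normF X.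
Proof.
move=> pP; have [QQ tQ] := orthoproj_compl pP; have [PP tP] := pP.
have split_tr : \tr (X^T *m X) = \tr ((P *m X)^T *m (P *m X))
    + \tr (((1%:M - P) *m X)^T *m ((1%:M - P) *m X)).
  rewrite -mxtraceD !trmx_mul tP tQ !mulmxA -(mulmxA X^T P P) PP.
  rewrite -(mulmxA X^T (1%:M - P)) QQ -mulmxDl -mulmxDr.
  by rewrite [P + _]addrC subrK mulmx1.
rewrite !normFE ler_wsqrtr// split_tr lerDl; exact: mxtrace_sqr_ge0.
Qed.

Lemma normF_mul_orthoproj P m (X : 'M[R]_(m, n)) :
  orthoproj P -> normF (X *m P) <= normF X.
Proof.
move=> pP; have [_ tP] := pP.
by rewrite -normF_tr trmx_mul tP -(normF_tr X) normF_orthoproj_mul.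
Qed.

(** Since P = P P^T, a diagonal entry is the sum of the squares of its row. Hence each squared entry
    is at most the diagonal entry of its row; applied to that diagonal entry itself, this bounds it
    by 1. *)
Lemma normr_orthoproj P i j : orthoproj P -> `|P i j| <= 1.
Proof.
move=> [PP tP].
have diag k : P k k = \sum_l P k l ^+ 2.
  rewrite -[in LHS]PP mxE; apply: eq_bigr => l _.
  by rewrite expr2 -[in X in _ * X = _]tP mxE.
have le_diag k l : P k l ^+ 2 <= P k k.
  rewrite [leRHS]diag (bigD1 l)//= lerDl.
  by apply: sumr_ge0 => ? _; exact: sqr_ge0.
have ii_le1 : P i i <= 1 by have := le_diag i i; nra.
by rewrite -(@expr_le1 _ 2)// real_normK ?num_real// (le_trans (le_diag i j)).
Qed.

(* The velocity at [P] of the curve of projectors obtained by moving the range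
   of [P] with infinitesimal generator [E]. *)
Definition proj_tangent P E : 'M[R]_n :=
  P *m E^T *m (1%:M - P) + (1%:M - P) *m E *m P.

(* The two summands are transposes of each other and square to zero. *)
Lemma norm0_proj_tangent P E :
  orthoproj P -> norm0 (proj_tangent P E) = normF ((1%:M - P) *m E *m P).
Proof.
move=> pP; have pQ := orthoproj_compl pP; have [_ tP] := pP; have [_ tQ] := pQ.
rewrite /proj_tangent; set Q := 1%:M - P in pQ tQ *.
have QP : Q *m P = 0 by exact: orthoproj_compl_mul.
have PQ : P *m Q = 0 by exact: orthoproj_mul_compl.
set A := Q *m E *m P.
have At : P *m E^T *m Q = A^T by rewrite /A !trmx_mul tP tQ mulmxA.
have AA : A *m A = 0 by rewrite /A !mulmxA -(mulmxA _ P Q) PQ mulmx0 !mul0mx.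
have AtAt : A^T *m A^T = 0 by rewrite -trmx_mul AA linear0.
rewrite At /norm0 /inner0 normFE [(_ + _)^T]linearD/= trmxK mulmxDl.
rewrite !mulmxDr AA AtAt.
rewrite addr0 add0r mxtraceD (mxtrace_mulC A) -mulr2n -(mulr_natl (\tr _)).
by rewrite mulrA mulVf ?mul1r// pnatr_eq0.
Qed.

Lemma norm0_proj_tangent_le P E :
  orthoproj P -> norm0 (proj_tangent P E) <= normF E.
Proof.
move=> pP; rewrite norm0_proj_tangent//.
apply: le_trans (normF_mul_orthoproj _ pP) _.
exact/normF_orthoproj_mul/orthoproj_compl.
Qed.

End OrthogonalProjectors.

(** * Projectors onto graphs, and the exact increment formula *)

Section GraphProjector.
Variables (R : realType) (p q n : nat) (e : (p + q)%N = n).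
Implicit Types B V : 'M[R]_(q, p).

Definition graph_frame B : 'M[R]_(n, p) := castmx (e, erefl) (col_mx 1%:M B).

Definition graph_gram B : 'M[R]_p := 1%:M + B^T *m B.

(** Keeping [n] a variable tied to [p + q] by [e] lets [case: n / e] remove every cast. The instance
    [q = n - p] is convertible to [phi]. *)
Definition graph_proj B : 'M[R]_n :=
  castmx (e, e)
    (col_mx 1%:M B *m invmx (1%:M + B^T *m B) *m row_mx 1%:M B^T).

Definition embed V : 'M[R]_n := castmx (e, e) (block_mx 0 0 V 0).

Lemma graph_projE B :
  graph_proj B = graph_frame B *m invmx (graph_gram B) *m (graph_frame B)^T.
Proof.
rewrite /graph_proj /graph_frame /graph_gram; case: n / e; rewrite !castmx_id.
by rewrite tr_col_mx trmx1.
Qed.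

Lemma graph_frame_gram B : (graph_frame B)^T *m graph_frame B = graph_gram B.
Proof.
rewrite /graph_frame /graph_gram; case: n / e; rewrite !castmx_id.
by rewrite tr_col_mx mul_row_col trmx1 mulmx1.
Qed.

(** The Gram matrix is positive definite: a row x in its kernel satisfies 0 = |x|^2 + |B x^T|^2, so
    x = 0. *)
Lemma graph_gram_unit B : graph_gram B \in unitmx.
Proof.
rewrite -row_free_unit -kermx_eq0; apply/eqP/row_matrixP => i; rewrite row0.
set x := row i _; have x_ker : x *m graph_gram B = 0.
  by apply/sub_kermxP; exact: row_sub.
have /(congr1 mxtrace) : x *m graph_gram B *m x^T = 0 by rewrite x_ker mul0mx.
rewrite /graph_gram mulmxDr mulmx1 mulmxDl mxtraceD linear0.
have -> : x *m (B^T *m B) *m x^T = (B *m x^T)^T *m (B *m x^T).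
  by rewrite trmx_mul trmxK !mulmxA.
have := mxtrace_sqr_ge0 (B *m x^T); have := mxtrace_sqr_ge0 x^T.
rewrite trmxK => x0 Bx0 /eqP; rewrite paddr_eq0// => /andP[/eqP xx _].
by apply: normF_eq0; rewrite -normF_tr normFE trmxK xx sqrtr0.
Qed.

Lemma graph_proj_frame B : graph_proj B *m graph_frame B = graph_frame B.
Proof.
rewrite graph_projE -mulmxA graph_frame_gram -mulmxA mulVmx ?mulmx1//.
exact: graph_gram_unit.
Qed.

Lemma graph_projP B : orthoproj (graph_proj B).
Proof.
split; first by rewrite [in X in _ *m X]graph_projE !mulmxA graph_proj_frame
  -graph_projE.
rewrite graph_projE !trmx_mul trmxK mulmxA trmx_inv; congr (_ *m invmx _ *m _).
by rewrite /graph_gram linearD/= trmx1 trmx_mul trmxK.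
Qed.

(** The rank is at most [p] because the projector factors through dimension [p], and at least [p]
    because it fixes the frame, which has rank [p]. *)
Lemma rank_graph_proj B : \rank (graph_proj B) = p.
Proof.
apply/eqP; rewrite eqn_leq; apply/andP; split.
  by rewrite graph_projE -mulmxA (leq_trans (mxrankM_maxl _ _))// rank_leq_col.
have fr : \rank (graph_frame B) = p.
  rewrite /graph_frame; case: n / e; rewrite castmx_id; apply/eqP.
  rewrite eqn_leq rank_leq_col/= -[leqLHS](mxrank1 R).
  (* A left inverse of the frame: the identity of size [p] factors through [col_mx 1%:M B], which
     therefore has rank at least [p]. *)
  have {1}-> : 1%:M = row_mx 1%:M 0 *m col_mx 1%:M B :> 'M[R]_p.
    by rewrite mul_row_col mul0mx mulmx1 addr0.
  exact: mxrankM_maxr.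
by rewrite -{1}fr -(graph_proj_frame B) mxrankM_maxl.
Qed.

Lemma Gr_graph_proj B : Gr p (graph_proj B).
Proof.
by have [PP tP] := graph_projP B; split=> //; exact: rank_graph_proj.
Qed.

Lemma embed_frame B V :
  embed V *m graph_frame B = graph_frame (B + V) - graph_frame B.
Proof.
rewrite /embed /graph_frame; case: n / e; rewrite !castmx_id.
rewrite mul_block_col !mul0mx mulmx1 !addr0 opp_col_mx add_col_mx subrr.
by rewrite addrAC subrr add0r.
Qed.

(* [1 + embed V] maps the range of [graph_proj B] onto that of
   [graph_proj (B + V)]. *)
Lemma graph_projB_compl B V :
  (1%:M - graph_proj (B + V)) *m embed V *m graph_proj B =
  - ((1%:M - graph_proj (B + V)) *m graph_proj B).
Proof.
apply/eqP; rewrite -addr_eq0 -!mulmxA -mulmxDr [graph_proj B]graph_projE.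
rewrite !mulmxA -!mulmxDl embed_frame subrK !mulmxA mulmxBl mul1mx.
by rewrite graph_proj_frame subrr !mul0mx.
Qed.

(** Write P' - P = P' (1 - P) - (1 - P') P. The second term is given by [graph_projB_compl]. The
    first is the transpose of the same identity read backwards, from [B + V] to [B] with increment
    [- V]. *)
Lemma graph_projB B V :
  graph_proj (B + V) - graph_proj B =
  graph_proj (B + V) *m (embed V)^T *m (1%:M - graph_proj B)
  + (1%:M - graph_proj (B + V)) *m embed V *m graph_proj B.
Proof.
have [_ tP] := graph_projP B; have [_ tP'] := graph_projP (B + V).
have embedN : embed (- V) = - embed V.
  rewrite /embed; case: n / e; rewrite !castmx_id.
  by rewrite opp_block_mx !oppr0.
have := graph_projB_compl (B + V) (- V); rewrite addrK embedN.
rewrite mulmxN mulNmx => /oppr_inj/(congr1 trmx).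
rewrite !trmx_mul linearB/= trmx1 tP tP' mulmxA => ->.
rewrite graph_projB_compl mulmxBl mulmxBr mulmx1 mul1mx opprB addrA subrK //.
Qed.

Lemma embed_linear : linear embed.
Proof.
move=> a V W; rewrite /embed; case: n / e; rewrite !castmx_id.
by rewrite scale_block_mx add_block_mx !scaler0 !addr0.
Qed.

Lemma normF_embed V : normF (embed V) = normF V.
Proof.
rewrite /embed; case: n / e; rewrite castmx_id !normFE.
rewrite tr_block_mx mulmx_block !trmx0 !mulmx0 !mul0mx !add0r.
by rewrite mxtrace_block mxtrace0 addr0.
Qed.

End GraphProjector.

(** * Sup-norm estimates and derivability of matrix-valued maps *)

Section MatrixNorm.
Variable R : realType.

Lemma ler_mx_norm_coord m n (A : 'M[R]_(m, n)) i j : `|A i j| <= `|A|.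
Proof.
rewrite [leRHS]/Num.Def.normr/= mx_normrE.
exact: (le_bigmax _ (fun ij => `|A ij.1 ij.2|) (i, j)).
Qed.

Lemma mx_norm_le m n (A : 'M[R]_(m, n)) a :
  0 <= a -> (forall i j, `|A i j| <= a) -> `|A| <= a.
Proof.
by move=> a0 Aa; rewrite /Num.Def.normr/= mx_normrE bigmax_le// => -[i j] _.
Qed.

Lemma mx_norm_mulmx m n p (A : 'M[R]_(m, n)) (B : 'M[R]_(n, p)) :
  `|A *m B| <= n%:R * (`|A| * `|B|).
Proof.
apply: mx_norm_le => [|i j]; first by rewrite !mulr_ge0.
rewrite mxE (le_trans (ler_norm_sum _ _ _))//.
rewrite (@le_trans _ _ (\sum_(k < n) `|A| * `|B|))//.
  by apply: ler_sum => k _; rewrite normrM ler_pM ?ler_mx_norm_coord.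
by rewrite sumr_const card_ord mulr_natl.
Qed.

Lemma mx_norm_tr m n (A : 'M[R]_(m, n)) : `|A^T| <= `|A|.
Proof. by apply: mx_norm_le => // i j; rewrite mxE ler_mx_norm_coord. Qed.

Lemma mx_norm_orthoproj n (P : 'M[R]_n) : orthoproj P -> `|P| <= 1.
Proof. by move=> pP; apply: mx_norm_le => // i j; exact: normr_orthoproj. Qed.

Lemma mx_norm_mulmx3 n (A B C : 'M[R]_n) :
  `|A *m B *m C| <= n%:R ^+ 2 * (`|A| * `|B| * `|C|).
Proof.
apply: le_trans (mx_norm_mulmx _ _) _.
rewrite expr2 -[leRHS]mulrA ler_wpM2l// [leRHS]mulrA ler_wpM2r//.
exact: mx_norm_mulmx.
Qed.

Lemma mx_norm_embed p q n (e : (p + q)%N = n) (V : 'M[R]_(q, p)) :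
  `|embed e V| <= `|V|.
Proof.
rewrite /embed; case: n / e; rewrite castmx_id; apply: mx_norm_le => // i j.
rewrite mxE; case: fintype.split => k; rewrite mxE; case: fintype.split => l;
  by rewrite ?mxE ?normr0// ler_mx_norm_coord.
Qed.

Section DerivableMatrix.
Variable V : normedModType R.

Lemma derivable_mulmx m n p (f : V -> 'M[R]_(m, n)) (g : V -> 'M[R]_(n, p))
    x v :
  derivable f x v -> derivable g x v -> derivable (fun y => f y *m g y) x v.
Proof.
move=> /derivable_mxP df /derivable_mxP dg; apply/derivable_mxP => i j.
have -> : (fun y => (f y *m g y) i j) =
    \sum_(k < n) ((fun y => f y i k) * (fun y => g y k j)).
  by apply/funext => y; rewrite mxE fct_sumE.
by apply: derivable_sum => k; exact: derivableM.
Qed.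

Lemma derivable_trmx m n (f : V -> 'M[R]_(m, n)) x v :
  derivable f x v -> derivable (fun y => (f y)^T) x v.
Proof.
move=> /derivable_mxP df; apply/derivable_mxP => i j.
by under eq_fun do rewrite mxE; exact: df.
Qed.

Lemma derivable_mxtrace n (f : V -> 'M[R]_n) x v :
  derivable f x v -> derivable (fun y => \tr (f y)) x v.
Proof.
move=> /derivable_mxP df.
have -> : (fun y => \tr (f y)) = \sum_(k < n) (fun y => f y k k).
  by apply/funext => y; rewrite fct_sumE.
by apply: derivable_sum => k; exact: df.
Qed.

End DerivableMatrix.

(** The square root is not differentiable at 0, so derivability is used only for the squared norm,
    and the root is composed by continuity. *)
Lemma continuous_norm0 n (f : R -> 'M[R]_n) :
  (forall t, derivable f t 1) -> continuous (fun t => norm0 (f t)).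
Proof.
move=> df t; apply: (@continuous_comp _ _ _ (fun t => inner0 (f t) (f t))).
  apply/differentiable_continuous/derivable1_diffP.
  apply: (@derivableM _ _ (cst 2^-1) (fun t => \tr ((f t)^T *m f t))) => //.
  by apply/derivable_mxtrace/derivable_mulmx => //; exact: derivable_trmx.
exact: sqrt_continuous.
Qed.

End MatrixNorm.

(** The bound by [L] makes [df] continuous, the quadratic remainder is little-o of [h], and a
    continuous linear map with such a remainder is the differential. *)
Lemma is_diff_quadratic (R : realType) (V W : normedModType R) (f : V -> W)
    (df : {linear V -> W}) (x : V) (K L : R) :
  (forall h, `|df h| <= L * `|h|) ->
  (forall h, `|f (x + h) - f x - df h| <= K * `|h| ^+ 2) ->
  is_diff x f df.
Proof.
move=> dfL fK.
have df_cont : continuous df.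
  apply: bounded_linear_continuous; exists `|L|; split; first exact: num_real.
  move=> M LM; near=> h; rewrite /= (le_trans (dfL h))//.
  rewrite (le_trans _ (ltW LM))// (le_trans (ler_wpM2r _ (ler_norm L)))//.
  rewrite ler_piMr//; near: h; exact: nbhs0_le.
have f_eq : f \o shift x = cst (f x) + df +o_ 0 id.
  apply/eqaddoP => _/posnumP[eps]; near=> h.
  have -> : (f \o shift x - (cst (f x) + df)) h = f (x + h) - f x - df h.
    by rewrite /= !fctE opprD addrA [x + h]addrC.
  rewrite (le_trans (fK h))// expr2 mulrA ler_wpM2r//.
  (* No sign is assumed on [K]; [|K| + 1] is a positive upper bound by which one can divide. *)
  have K0 : 0 < `|K| + 1 by rewrite ltr_wpDl.
  rewrite (@le_trans _ _ ((`|K| + 1) * `|h|))//.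
    by rewrite ler_wpM2r// (le_trans (ler_norm K))// lerDl.
  rewrite -ler_pdivlMl//; near: h; apply: nbhs0_le.
have d_eq := diff_unique df_cont f_eq.
by split=> //; apply/diff_locallyP; rewrite d_eq.
Unshelve. all: by end_near. Qed.

(** * Differential of the graph projector *)

Section GraphProjectorDifferential.
Variables (R : realType) (p q n : nat) (e : (p + q)%N = n).
Implicit Types B V D : 'M[R]_(q, p).
Local Notation graph_proj := (@graph_proj R p q n e).
Local Notation embed := (@embed R p q n e).

Lemma proj_tangent_embed_linear (P : 'M[R]_n) :
  linear (fun V => proj_tangent P (embed V)).
Proof.
move=> a V W; rewrite /proj_tangent; move: (1%:M - P) => Q.
rewrite embed_linear linearP/=.
rewrite !mulmxDr !mulmxDl -!scalemxAr -!scalemxAl scalerDr.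
by rewrite addrACA.
Qed.

(** Covers both the increment of [graph_proj] and its linear part, which have this shape. The two
    products in each summand cost [n%:R ^+ 2], and projectors have sup norm at most 1. *)
Lemma mx_norm_orthoproj_embed (P Q P' Q' : 'M[R]_n) V :
  orthoproj P -> orthoproj Q -> orthoproj P' -> orthoproj Q' ->
  `|P *m (embed V)^T *m Q + P' *m embed V *m Q'| <= n%:R ^+ 2 * `|V| *+ 2.
Proof.
have bound (S T E : 'M[R]_n) : orthoproj S -> orthoproj T -> `|E| <= `|V| ->
    `|S *m E *m T| <= n%:R ^+ 2 * `|V|.
  move=> /mx_norm_orthoproj S1 /mx_norm_orthoproj T1 EV.
  rewrite (le_trans (mx_norm_mulmx3 _ _ _))// ler_wpM2l ?sqr_ge0//.
  by rewrite -[leRHS]mulr1 ler_pM ?mulr_ge0// -[leRHS]mul1r ler_pM.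
move=> pP pQ pP' pQ'; rewrite (le_trans (ler_normD _ _))//.
rewrite mulr2n lerD// bound//.
  by rewrite (le_trans (mx_norm_tr _))// mx_norm_embed.
exact: mx_norm_embed.
Qed.

Lemma mx_norm_graph_projB B V :
  `|graph_proj (B + V) - graph_proj B| <= n%:R ^+ 2 * `|V| *+ 2.
Proof.
have projP B' := graph_projP e B'; rewrite graph_projB.
by apply: mx_norm_orthoproj_embed => //; exact: orthoproj_compl.
Qed.

Lemma mx_norm_proj_tangent_embed B V :
  `|proj_tangent (graph_proj B) (embed V)| <= n%:R ^+ 2 * `|V| *+ 2.
Proof.
have projP := graph_projP e B.
by apply: mx_norm_orthoproj_embed => //; exact: orthoproj_compl.
Qed.

(** Subtracting the tangent vector from the exact increment replaces the left factor of each summand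
    by P' - P up to sign. This is itself O(V), so the rest is quadratic. Each summand contributes
    n^2 from the products times 2 n^2 from [mx_norm_graph_projB]. *)
Lemma mx_norm_graph_projB_tangent B V :
  `|graph_proj (B + V) - graph_proj B - proj_tangent (graph_proj B) (embed V)|
  <= (n%:R ^+ 4 *+ 4) * `|V| ^+ 2.
Proof.
set P' := graph_proj (B + V); set P := graph_proj B; set E := embed V.
have -> : P' - P - proj_tangent P E =
    (P' - P) *m E^T *m (1%:M - P) - (P' - P) *m E *m P.
  rewrite [in LHS]graph_projB -/P -/P' -/E /proj_tangent opprD addrACA.
  congr (_ + _); rewrite -!mulmxBl// -!mulNmx; congr (_ *m _ *m _).
  by rewrite !opprB [LHS]addrC addrA subrK.
have bound (Q F : 'M[R]_n) : orthoproj Q -> `|F| <= `|V| ->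
    `|(P' - P) *m F *m Q| <= n%:R ^+ 4 *+ 2 * `|V| ^+ 2.
  move=> /mx_norm_orthoproj Q1 FV.
  rewrite (le_trans (mx_norm_mulmx3 _ _ _))//.
  have -> : n%:R ^+ 4 *+ 2 * `|V| ^+ 2 =
    n%:R ^+ 2 * ((n%:R ^+ 2 * `|V| *+ 2) * `|V| * 1) by ring.
  rewrite ler_wpM2l ?sqr_ge0// ler_pM ?mulr_ge0// ler_pM//.
  exact: mx_norm_graph_projB.
have pP := graph_projP e B; have EV : `|E| <= `|V| by exact: mx_norm_embed.
rewrite (le_trans (ler_normB _ _))//.
have -> : n%:R ^+ 4 *+ 4 * `|V| ^+ 2 =
  n%:R ^+ 4 *+ 2 * `|V| ^+ 2 + n%:R ^+ 4 *+ 2 * `|V| ^+ 2 by ring.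
rewrite lerD// bound ?(le_trans (mx_norm_tr _))//.
exact: orthoproj_compl.
Qed.

Lemma is_diff_graph_proj B :
  is_diff B graph_proj (fun V => proj_tangent (graph_proj B) (embed V)).
Proof.
pose linM := GRing.isLinear.Build _ _ _ _ _
  (proj_tangent_embed_linear (graph_proj B)).
pose dP : {linear _ -> _} :=
  HB.pack (fun V => proj_tangent (graph_proj B) (embed V)) linM.
apply: (@is_diff_quadratic _ _ _ _ dP _ (n%:R ^+ 4 *+ 4) (n%:R ^+ 2 *+ 2)) => V.
  by rewrite mulrnAl; exact: mx_norm_proj_tangent_embed.
exact: mx_norm_graph_projB_tangent.
Qed.

Lemma is_diff_line B D t :
  is_diff t (fun s : R => B + s *: D) (fun s : R => s *: D).
Proof.
have := @is_diffD _ _ _ (cst B) _ _ _ t (is_diff_cst B t) (is_diff_scalel t D).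
by rewrite add0r.
Qed.

Lemma graph_proj_line_diff B D t :
  differentiable (fun s : R => graph_proj (B + s *: D)) t.
Proof.
apply: (@differentiable_comp _ _ _ _ (fun s : R => B + s *: D) graph_proj).
  exact: (@ex_diff _ _ _ _ _ _ _ (is_diff_line B D t)).
exact: (@ex_diff _ _ _ _ _ _ _ (is_diff_graph_proj _)).
Qed.

Lemma derive1_graph_proj_line B D t :
  derive1 (fun s : R => graph_proj (B + s *: D)) t =
  'd graph_proj (B + t *: D) D.
Proof.
rewrite derive1E'; last exact: graph_proj_line_diff.
have dl := is_diff_line B D t; have dg := is_diff_graph_proj (B + t *: D).
rewrite (@diff_comp _ _ _ _ (fun s : R => B + s *: D) graph_proj)//=.
by rewrite (@diff_val _ _ _ _ _ _ _ dl) scale1r.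
Qed.

Lemma diff_graph_projE B V :
  'd graph_proj B V = proj_tangent (graph_proj B) (embed V).
Proof. by rewrite (@diff_val _ _ _ _ _ _ _ (is_diff_graph_proj B)). Qed.

(** The velocity is a polynomial in the curve itself and constant matrices, so it inherits
    derivability from the curve. Its continuity, required by [C1], follows. *)
Lemma derivable_diff_graph_proj_line B D t :
  derivable (fun s : R => 'd graph_proj (B + s *: D) D) t 1.
Proof.
under eq_fun do rewrite diff_graph_projE.
have dc : derivable (fun s : R => graph_proj (B + s *: D)) t 1.
  exact/derivable1_diffP/graph_proj_line_diff.
have dcst (A : 'M[R]_n) : derivable (cst A : R -> _) t 1.
  exact: derivable_cst.
have dQ : derivable (fun s : R => 1%:M - graph_proj (B + s *: D)) t 1.
  exact: (derivableB (dcst 1%:M) dc).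
apply: derivableD.
  exact: (derivable_mulmx (derivable_mulmx dc (dcst (embed D)^T)) dQ).
exact: (derivable_mulmx (derivable_mulmx dQ (dcst (embed D))) dc).
Qed.

Lemma norm0_diff_graph_proj_le B V : norm0 ('d graph_proj B V) <= normF V.
Proof.
rewrite diff_graph_projE -(normF_embed e); apply: norm0_proj_tangent_le.
exact: graph_projP.
Qed.

End GraphProjectorDifferential.

(** * Linear lower bound and cubic remainder for the arcsine *)

Lemma asin_mean_value (R : realType) (x : R) :
  0 <= x < 1 -> exists2 c, 0 <= c <= x & asin x = x / Num.sqrt (1 - c ^+ 2).
Proof.
move=> /andP[x0 x1].
have dasin y : y \in `]0, x[ -> is_derive y 1 asin (Num.sqrt (1 - y ^+ 2))^-1.
  rewrite in_itv/= => /andP[y0 yx]; apply: is_derive1_asin; lra.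
have asin_cont : {within `[0, x], continuous (@asin R)}.
  apply: continuous_in_subspaceT => y; rewrite inE/= in_itv/= => /andP[y0 yx].
  by apply: continuous_asin; lra.
have [c] := MVT_segment x0 dasin asin_cont; rewrite in_itv/= => cx.
have asin0 : asin 0 = 0 :> R.
  by rewrite -{1}sin0 sinK// in_itv/= oppr_le0 divr_ge0 ?pi_ge0.
by rewrite asin0 !subr0 mulrC => ->; exists c.
Qed.

(** The denominator in [asin_mean_value] lies in ]0, 1]. *)
Lemma ge_id_asin (R : realType) (x : R) : 0 <= x < 1 -> x <= asin x.
Proof.
move=> x01; have [c /andP[c0 cx] ->] := asin_mean_value x01.
have /andP[x0 x1] := x01.
have c2_lt1 : 0 < 1 - c ^+ 2 by nra.
rewrite ler_pdivlMr ?sqrtr_gt0// ler_piMr// -[leRHS]sqrtr1 ler_wsqrtr//.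
by rewrite gerBl sqr_ge0.
Qed.

Lemma asin_cubic (R : realType) (x : R) :
  0 <= x <= 2^-1 -> `|asin x - x| <= 2 * x ^+ 3.
Proof.
move=> /andP[x0 x12]; have x01 : 0 <= x < 1 by lra.
rewrite ger0_norm ?subr_ge0 ?ge_id_asin//.
have [c /andP[c0 cx] ->] := asin_mean_value x01.
set s := Num.sqrt _.
have s_ge0 : 0 <= s by exact: sqrtr_ge0.
have s2 : s ^+ 2 = 1 - c ^+ 2 by rewrite sqr_sqrtr//; nra.
(* As s^2 = 1 - c^2 is at most 1, so is s, and hence s^2 <= s. *)
have s_ge : 1 - c ^+ 2 <= s by nra.
have s0 : 0 < s by nra.
rewrite lerBlDr ler_pdivrMr//.
have -> : (2 * x ^+ 3 + x) * s = x * ((2 * x ^+ 2 + 1) * s) by ring.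
(* It remains to see 1 <= (2 x^2 + 1)(1 - x^2) = 1 + x^2 (1 - 2 x^2), which holds as soon as x^2 <=
   1/2. *)
have s_gex : 1 - x ^+ 2 <= s by nra.
rewrite ler_peMr//; apply: le_trans (ler_wpM2l _ s_gex); last by nra.
have x2 : x ^+ 2 <= 2^-1 by nra.
have := sqr_ge0 x; nra.
Qed.

(** * Length of curves and the distance *)

Section CurveLength.
Variables (R : realType) (n p : nat).
Implicit Types c : R -> 'M[R]_n.

Lemma curve_length_ge0 c : 0 <= curve_length c.
Proof. by apply: Rintegral_ge0 => t _; exact: norm0_ge0. Qed.

Lemma dist_le_curve_length c :
  piecewise_C1 c -> (forall t, t \in `[0, 1] -> Gr p (c t)) ->
  dist p (c 0) (c 1) <= curve_length c.
Proof.
move=> cC1 cGr; apply: ge_inf; last by exists c.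
(* Lengths are bounded below by 0, so the infimum is a genuine lower bound. *)
by exists 0 => _ [d _ <-]; exact: curve_length_ge0.
Qed.

Lemma C1_piecewise_C1 c : C1 c -> piecewise_C1 c.
Proof.
move=> cC1; exists [:: 1]; split; first exact: itv_partition1.
by move=> i _; exists c.
Qed.

Lemma curve_length_le c K :
  continuous (fun t => norm0 (derive1 c t)) ->
  (forall t, 0 <= t <= 1 -> norm0 (derive1 c t) <= K) -> curve_length c <= K.
Proof.
move=> c'_cont c'_le.
have integrable01 (f : R -> R) : continuous f ->
    lebesgue_measure.-integrable `[0, 1] (EFin \o f).
  move=> fc; apply: continuous_compact_integrable; first exact: segment_compact.
  exact: continuous_subspaceT.
(* [K] is its own integral over the unit interval, so monotonicity of the integral applies. *)
have <- : \int[lebesgue_measure]_(t in `[0%R, 1%R]) K = K.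
  rewrite Rintegral_cst//= lebesgue_measure_itv/= lte_fin ltr01 sube0/=.
  by rewrite mulr1.
apply: le_Rintegral => //; first exact: integrable01.
by apply: integrable01 => t; exact: cst_continuous.
Qed.

End CurveLength.

(** * Operator norm of the differential and the distance bound *)

Section OperatorNorm.
Variables (R : realType) (n p : nat) (hp : (0 < p)%N) (hpn : (p < n)%N).
Implicit Types B V : 'M[R]_(n - p, p).
Local Notation phi := (@phi R n p (ltnW hpn)).
Local Notation opnorm := (@dphi_opnorm R n p (ltnW hpn)).
Local Notation segment_max := (@segment_max R n p (ltnW hpn)).

Lemma phiE : phi = @graph_proj R p (n - p) n (subnKC (ltnW hpn)).
Proof. by []. Qed.

(** Together with [dphi_opnorm_nonempty], this makes the [sup] in [dphi_opnorm] a true least upper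
    bound. *)
Lemma norm0_dphi_ubound B :
  ubound [set norm0 ('d phi B V) | V in [set V | normF V = 1]] 1.
Proof.
by move=> _ [V <- <-]; rewrite phiE; exact: norm0_diff_graph_proj_le.
Qed.

(** Since 0 < p < n the matrices have at least one entry, and the elementary matrix at that entry
    has norm 1. *)
Lemma dphi_opnorm_nonempty B :
  [set norm0 ('d phi B V) | V in [set V | normF V = 1]] !=set0.
Proof.
have q0 : (0 < n - p)%N by rewrite subn_gt0.
pose U : 'M[R]_(n - p, p) := delta_mx (Ordinal q0) (Ordinal hp).
exists (norm0 ('d phi B U)), U => //=.
rewrite /normF (bigD1 (Ordinal q0))//= (bigD1 (Ordinal hp))//= !mxE !eqxx.
rewrite big1 => [|j /negPf jN]; last by rewrite mxE jN andbF expr0n.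
rewrite big1 => [|i /negPf iN]; last first.
  by rewrite big1// => j _; rewrite mxE iN expr0n.
by rewrite !addr0 expr1n sqrtr1.
Qed.

Lemma dphi_opnorm_le1 B : opnorm B <= 1.
Proof. exact: ge_sup (dphi_opnorm_nonempty B) (@norm0_dphi_ubound B). Qed.

Lemma norm0_dphi_le B V : norm0 ('d phi B V) <= opnorm B * normF V.
Proof.
have [V0|V_neq0] := eqVneq (normF V) 0.
  (* A zero [V] cannot be normalized. The right side 0 is turned back into [normF V], which bounds
     the left side. *)
  by rewrite V0 mulr0 -V0 phiE norm0_diff_graph_proj_le.
have V_gt0 : 0 < normF V by rewrite lt_neqAle eq_sym V_neq0 normF_ge0.
rewrite -ler_pdivrMr// mulrC -(ger0_norm (normF_ge0 V)) -normfV -norm0Z.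
rewrite -linearZ; apply: ub_le_sup.
  by exists 1; exact: norm0_dphi_ubound.
exists ((normF V)^-1 *: V) => //=.
by rewrite normFZ ger0_norm ?invr_ge0 ?normF_ge0// mulVf.
Qed.

Lemma opnorm_segment_ubound B Bt :
  ubound [set opnorm (Bt + t *: (B - Bt)) | t in `[0, 1]] 1.
Proof. by move=> _ [t _ <-]; exact: dphi_opnorm_le1. Qed.

Lemma opnorm_le_segment_max B Bt t :
  0 <= t <= 1 -> opnorm (Bt + t *: (B - Bt)) <= segment_max B Bt.
Proof.
move=> t01; apply: ub_le_sup; last by exists t => //=; rewrite in_itv.
by exists 1; exact: opnorm_segment_ubound.
Qed.

Lemma segment_max_le1 B Bt : segment_max B Bt <= 1.
Proof.
apply: ge_sup; last exact: opnorm_segment_ubound.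
by exists (opnorm (Bt + 0 *: (B - Bt))), 0 => //=; rewrite in_itv/= lexx ler01.
Qed.

(** The supremum dominates the operator norm at t = 0, which dominates the nonnegative [norm0] of
    the image of some unit matrix. *)
Lemma segment_max_ge0 B Bt : 0 <= segment_max B Bt.
Proof.
apply: le_trans (opnorm_le_segment_max B Bt (t := 0) _); last first.
  by rewrite lexx ler01.
have [x [V V1 Vx]] := dphi_opnorm_nonempty (Bt + 0 *: (B - Bt)).
have := norm0_dphi_le (Bt + 0 *: (B - Bt)) V; rewrite V1 mulr1.
by apply: le_trans; exact: norm0_ge0.
Qed.

Lemma dist_phi_le B Bt :
  dist p (phi B) (phi Bt) <= segment_max B Bt * normF (B - Bt).
Proof.
pose c t := phi (B + t *: (Bt - B)).
have c' : derive1 c = fun t => 'd phi (B + t *: (Bt - B)) (Bt - B).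
  by apply/funext => t; rewrite /c phiE derive1_graph_proj_line.
have c'_derivable t : derivable (derive1 c) t 1.
  by rewrite c' phiE; exact: derivable_diff_graph_proj_line.
have C1c : C1 c.
  (* The derivative of [c] is continuous because it is itself derivable. *)
  split=> t; last exact/differentiable_continuous/derivable1_diffP.
  by apply/derivable1_diffP; exact: graph_proj_line_diff.
have -> : phi B = c 0 by rewrite /c scale0r addr0.
have -> : phi Bt = c 1 by rewrite /c scale1r addrC subrK.
apply: le_trans (dist_le_curve_length (C1_piecewise_C1 C1c) _) _.
  by move=> t _; exact: Gr_graph_proj.
apply: curve_length_le => [|t /andP[t0 t1]]; first exact: continuous_norm0.
rewrite c' (le_trans (norm0_dphi_le _ _))// -normFN opprB.
rewrite ler_wpM2r ?normF_ge0//.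
(* The curve runs from [B] to [Bt], whereas [segment_max] runs from [Bt] to [B]; the parameters
   correspond by t -> 1 - t. *)
have -> : B + t *: (Bt - B) = Bt + (1 - t) *: (B - Bt).
  rewrite scalerBl scale1r addrA [Bt + (_ - _)]addrC subrK.
  by rewrite -scalerN opprB.
by apply: opnorm_le_segment_max; lra.
Qed.

End OperatorNorm.

Theorem theorem2 (R : realType) (n p : nat)
    (hp : (1 <= p)%N) (hpn : (p < n)%N) :
  let phi := @phi R n p (ltnW hpn) in
  let M := @segment_max R n p (ltnW hpn) in
  [/\ forall B Bt : 'M[R]_(n - p, p),
        normF (B - Bt) < 1 / M B Bt ->
        dist p (phi B) (phi Bt) < pi / 2 ->
        dist p (phi B) (phi Bt) <= asin (M B Bt * normF (B - Bt)),
      exists C delta : R, 0 < delta /\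
        forall B Bt : 'M[R]_(n - p, p),
          normF (B - Bt) < delta ->
          `|asin (M B Bt * normF (B - Bt)) - M B Bt * normF (B - Bt)|
            <= C * normF (B - Bt) ^+ 3
    & forall B Bt : 'M[R]_(n - p, p),
        M B Bt <= Num.sqrt (5 / 2) + 1].
Proof.
move=> phi M.
have M_ge0 B Bt : 0 <= M B Bt by exact: segment_max_ge0.
have M_le1 B Bt : M B Bt <= 1 by exact: segment_max_le1.
split=> [B Bt BBt _||B Bt]; last first.
- by rewrite (le_trans (M_le1 B Bt))// lerDr sqrtr_ge0.
(* Both constants come from [asin_cubic]: as M <= 1, its argument x = M |B - Bt| is at most |B - Bt|
   < 1/2, and x^3 is at most |B - Bt|^3. *)
- exists 2, 2^-1; split=> [|B Bt BBt]; first by rewrite invr_gt0.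
  have d0 := normF_ge0 (B - Bt).
  have x0 : 0 <= M B Bt * normF (B - Bt) by rewrite mulr_ge0.
  have xd : M B Bt * normF (B - Bt) <= normF (B - Bt) by rewrite ler_piMl.
  rewrite (le_trans (asin_cubic _)) ?x0 ?(le_trans xd (ltW BBt))//.
  by rewrite ler_pM2l// lerXn2r.
- have d0 := normF_ge0 (B - Bt).
  (* If [M] were 0, then [1 / M] would be 0 by convention, and no norm lies below 0. *)
  have M_gt0 : 0 < M B Bt.
    by have := le_lt_trans d0 BBt; rewrite div1r invr_gt0.
  apply: le_trans (dist_phi_le hp hpn B Bt) (ge_id_asin _).
  by rewrite mulr_ge0//= mulrC -ltr_pdivlMr.
Qed.
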